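(* Let $\mathcal{H}$ be a real Hilbert space, let $\theta\in(0,1]$, and let $T:\mathcal{H}\to\mathcal{H}$ be a $\theta$-averaged operator. Let $\alpha>2$, $x_0,x_1\in\mathcal{H}$, $0<s\le \frac1\theta$, and let $(x_k)_{k\ge0}$ be the sequence generated by the Fast KM algorithm, i.e. for every $k\ge1$ $$x_{k+1}:=\left(1-\frac{s\alpha}{2(k+\alpha)}\right)x_k+\frac{(1-s)k}{k+\alpha}(x_k-x_{k-1})+\frac{s\alpha}{2(k+\alpha)}T(x_k)+\frac{sk}{k+\alpha}\bigl(T(x_k)-T(x_{k-1})\bigr).$$ Then $(x_k)_{k\ge0}$ converges weakly to an element of $\mathrm{Fix}\,T$ as $k\to+\infty$.
   Context: An operator $R:\mathcal{H}\to\mathcal{H}$ is nonexpansive if $\|R(x)-R(y)\|\le\|x-y\|$ for all $x,y\in\mathcal{H}$. For $\theta\in(0,1]$, $T:\mathcal{H}\to\mathcal{H}$ is $\theta$-averaged if there is a nonexpansive $R:\mathcal{H}\to\mathcal{H}$ with $T=(1-\theta)\mathrm{Id}+\theta R$, where $\mathrm{Id}$ is the identity on $\mathcal{H}$. $\mathrm{Fix}\,T:=\{x\in\mathcal{H}: x=T(x)\}$.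
   Formalization: The formal theorem additionally assumes that Fix T is nonempty; without this the claim is false, e.g. for T(x) = x + 1 on the real line with θ = 1, where Fix T is empty. *)

(* Defs.v *)
From HB Require Import structures.
From mathcomp Require Import all_boot all_order all_algebra.
From mathcomp Require Import all_classical all_reals all_analysis.

Set Implicit Arguments.
Unset Strict Implicit.
Unset Printing Implicit Defensive.
Import Order.TTheory GRing.Theory Num.Theory.
Import numFieldNormedType.Exports.

Local Open Scope classical_set_scope.
Local Open Scope ring_scope.

(* A real Hilbert space is a complete normed module H together with a
   positive definite symmetric bilinear form [ip : {dot H for idfun}]
   inducing the norm of H. *)
Definition induces_norm (R : realType) (H : completeNormedModType R)
    (ip : {dot H for idfun}) : Prop :=
  forall x : H, ip x x = `|x| ^+ 2.

Definition nonexpansive (R : realType) (H : normedModType R) (S : H -> H) : Prop :=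
  forall x y : H, `|S x - S y| <= `|x - y|.

(* The range 0 < theta <= 1 is not part of this predicate. *)
Definition averaged (R : realType) (H : normedModType R) (theta : R) (T : H -> H)
    : Prop :=
  exists S : H -> H, nonexpansive S /\
    forall x : H, T x = (1 - theta) *: x + theta *: S x.

Definition Fix (H : Type) (T : H -> H) : set H := [set x | x = T x].

Definition weakly_converges (R : realType) (H : completeNormedModType R)
    (ip : {dot H for idfun}) (x : nat -> H) (p : H) : Prop :=
  forall u : H, (fun k : nat => ip (x k) u) @ \oo --> ip p u.

Definition fast_KM (R : realType) (H : normedModType R) (T : H -> H)
    (alpha s : R) (x0 x1 : H) (x : nat -> H) : Prop :=
  [/\ x 0%N = x0, x 1%N = x1 &
    forall k : nat, (1 <= k)%N ->
      x k.+1 =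
        (1 - s * alpha / (2 * (k%:R + alpha))) *: x k
        + ((1 - s) * k%:R / (k%:R + alpha)) *: (x k - x k.-1)
        + (s * alpha / (2 * (k%:R + alpha))) *: T (x k)
        + (s * k%:R / (k%:R + alpha)) *: (T (x k) - T (x k.-1))].

(* Main.v *)
(* Put Q = s (Id - T), so that Id - Q is nonexpansive and Q is cocoercive, and
   v_{k+1} = x_{k+1} - x_k + Q x_k.  The algorithm becomes
   (k + alpha) v_{k+1} = k v_k + (alpha / 2) Q x_k.  For z in Fix T put
   A_k = (alpha - 1) |x_k - z|^2 + 2 k <x_k - z, v_k> and
   B_k = (k^2 / 2) (|v_k|^2 + |v_k - Q x_k|^2).  For 1 < lam < alpha - 1 the
   energy lam A_k + B_k is nonnegative and eventually decreases by at least a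
   constant times k (|v_{k+1}|^2 + |x_{k+1} - x_k|^2), hence by at least a
   constant times B_{k+1} / k.  Comparing two values of lam, A_k and B_k
   converge, and B_k tends to 0 because the harmonic series diverges.  Thus
   Q x_k tends to 0 and |x_k - z| converges for every z in Fix T, and Opial's
   argument applies.  Weak compactness is obtained by taking limits along
   ultrafilters, represented by vectors through Riesz's theorem. *)

Require Import Defs.
From HB Require Import structures.
From mathcomp Require Import all_boot all_order all_algebra.
From mathcomp Require Import all_classical all_reals all_analysis.
From mathcomp Require Import ring lra.
Set Implicit Arguments.
Unset Strict Implicit.
Unset Printing Implicit Defensive.
Import Order.TTheory GRing.Theory Num.Theory.
Import numFieldNormedType.Exports.
Local Open Scope classical_set_scope.
Local Open Scope ring_scope.

(** * Real inner products and the Cauchy-Schwarz inequality *)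

Section InnerProduct.
Context {R : realType} {H : completeNormedModType R} {ip : {dot H for idfun}}.
Implicit Types x y z : H.

Lemma ipC x y : ip x y = ip y x.
Proof. by rewrite hermC /= expr0 mul1r. Qed.
Lemma ipDl x y z : ip (x + y) z = ip x z + ip y z.
Proof. by rewrite linearDl. Qed.
Lemma ipDr x y z : ip x (y + z) = ip x y + ip x z.
Proof. by rewrite linearDr. Qed.
Lemma ipNl x y : ip (- x) y = - ip x y.
Proof. by rewrite linearNl. Qed.
Lemma ipNr x y : ip x (- y) = - ip x y.
Proof. by rewrite linearNr. Qed.
Lemma ipZl (a : R) x y : ip (a *: x) y = a * ip x y.
Proof. by rewrite linearZl_LR. Qed.
Lemma ipZr (a : R) x y : ip x (a *: y) = a * ip x y.
Proof. by rewrite linearZr_LR. Qed.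

Definition ipE := (ipDl, ipDr, ipNl, ipNr, ipZl, ipZr).

Hypothesis ip_norm : induces_norm ip.

Lemma ip_ge0 x : 0 <= ip x x.
Proof. by rewrite ip_norm sqr_ge0. Qed.

Lemma ip_eq0 x : ip x x = 0 -> x = 0.
Proof. by rewrite ip_norm => /eqP; rewrite sqrf_eq0 normr_eq0 => /eqP. Qed.

Lemma ip_ext y w : (forall u, ip y u = ip w u) -> y = w.
Proof.
move=> h; apply/eqP; rewrite -subr_eq0; apply/eqP/ip_eq0.
by rewrite ipDl ipNl h subrr.
Qed.

(** Expand | |y|^2 x - <x, y> y |^2 >= 0 and divide by |y|^2. *)
Lemma ip_sqr_le x y : ip x y ^+ 2 <= ip x x * ip y y.
Proof.
have [/ip_eq0 ->|y0] := eqVneq (ip y y) 0.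
  by rewrite -(scale0r 0) !ipE; lra.
have ylt : 0 < ip y y by rewrite lt_neqAle eq_sym y0 ip_ge0.
have := ip_ge0 (ip y y *: x - ip x y *: y).
rewrite !ipE (ipC y x) => h.
rewrite -(ler_pM2l ylt) -subr_ge0; apply: le_trans h _.
by rewrite le_eqVlt; apply/orP; left; apply/eqP; ring.
Qed.

Lemma ip_norm_le x y : `|ip x y| <= `|x| * `|y|.
Proof.
rewrite -(@ler_pXn2r _ 2)// ?nnegrE ?mulr_ge0// real_normK ?num_real//.
by rewrite exprMn -!ip_norm ip_sqr_le.
Qed.

End InnerProduct.

(** * One-step energy estimates *)

Section Energy.
Context {R : realType} {H : completeNormedModType R} {ip : {dot H for idfun}}.
Hypothesis ip_norm : induces_norm ip.
Implicit Types X m v e q : H.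

Definition energyA (alpha : R) X m : R :=
  (alpha - 1) * ip X X + 2 * ip X m.

Definition energyB (k : R) m q : R :=
  (ip m m + ip (m - k *: q) (m - k *: q)) / 2.

Lemma energyB_ge0 k m q : 0 <= energyB k m q.
Proof. by rewrite divr_ge0// addr_ge0// ip_ge0. Qed.

(** The gap is |2 m - k q|^2. *)
Lemma energyB_ge_residual k m q : k ^+ 2 * ip q q <= 4 * energyB k m q.
Proof.
rewrite -subr_ge0; apply: (le_trans (ip_ge0 ip_norm (2 *: m - k *: q))).
rewrite le_eqVlt; apply/orP; left; apply/eqP.
by rewrite /energyB !ipE (ipC q m); field.
Qed.

(** Completing the square, the gap is |lam X + m - (k/2) q|^2 + k^2 |q|^2 / 4 + lam k <X, q>. *)
Lemma energy_ge (alpha lam k : R) X m q : 0 <= lam -> 0 <= k -> 0 <= ip X q ->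
  lam * (alpha - 1 - lam) * ip X X <=
  lam * energyA alpha X m + energyB k m q.
Proof.
move=> lam0 k0 Xq0.
have h1 := ip_ge0 ip_norm (lam *: X + m - (k / 2) *: q).
have h2 : 0 <= k ^+ 2 * ip q q / 4 by rewrite !mulr_ge0// ?sqr_ge0// ip_ge0.
have h3 : 0 <= lam * k * ip X q by rewrite !mulr_ge0.
rewrite -subr_ge0; apply: (le_trans (addr_ge0 (addr_ge0 h1 h2) h3)).
rewrite le_eqVlt; apply/orP; left; apply/eqP.
by rewrite /energyA /energyB !ipE (ipC m X) (ipC q X) (ipC q m); field.
Qed.

(** Along the iterates the long argument on the right is k v_k and v - e is Q x_k, so the term in
    alpha - 2 is nonpositive by monotonicity. *)
Lemma energyA_step (alpha k : R) X v e :
  energyA alpha (X + e) ((k + 1) *: v) =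
  energyA alpha X ((k + alpha / 2) *: v + (alpha / 2) *: e)
  - (alpha - 2) * ip X (v - e) + (alpha - 1) * ip e e + 2 * (k + 1) * ip e v.
Proof. by rewrite /energyA !ipE (ipC e X); field. Qed.

(** The vector q enters [energyB k (k *: v) q] only through <v, q> - |q|^2 / 2, and replacing q by v
    - e gives exactly the right-hand side. *)
Lemma energyB_le (k : R) v e q :
  ip v (v - e) - ip (v - e) (v - e) / 2 <= ip v q - ip q q / 2 ->
  energyB k (k *: v) q <= k ^+ 2 / 2 * (ip v v + ip e e).
Proof.
move=> mono; rewrite -subr_ge0.
have h : 0 <= k ^+ 2 * (ip v q - ip q q / 2 -
  (ip v (v - e) - ip (v - e) (v - e) / 2)).
  by rewrite mulr_ge0 ?sqr_ge0// subr_ge0.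
apply: (le_trans h); rewrite le_eqVlt; apply/orP; left; apply/eqP.
by rewrite /energyB !ipE (ipC q v) (ipC e v); field.
Qed.

(* With X = x_k - z, v = v_{k+1} and e = x_{k+1} - x_k, one has v - e = Q x_k,
   and the first hypothesis is k v_k = (k + alpha) v_{k+1} - (alpha / 2) Q x_k.
   The last one, with q = Q x_{k+1}, is cocoercivity along the step e. *)
Lemma energy_step (alpha lam eps k : R) X m v e q :
  m = (k + alpha / 2) *: v + (alpha / 2) *: e ->
  2 < alpha -> 0 <= lam -> 0 <= k ->
  `|2 * lam - alpha| <= alpha - 2 - 4 * eps ->
  1 / 2 + lam * alpha <= eps * k ->
  0 <= ip X (v - e) ->
  ip v (v - e) - ip (v - e) (v - e) / 2 <= ip v q - ip q q / 2 ->
  lam * energyA alpha (X + e) ((k + 1) *: v)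
    + energyB (k + 1) ((k + 1) *: v) q + eps * k * (ip v v + ip e e) <=
  lam * energyA alpha X m + energyB k m (v - e).
Proof.
move=> mE a2 lam0 k0 hlam hk hX mono.
have hB := energyB_le (k + 1) mono.
rewrite energyA_step -mE.
(* By [mE], m - k (v - e) = (alpha/2) v + (k + alpha/2) e: the coefficients of m are swapped, so
   only |v|^2 + |e|^2 and <v, e> remain. *)
have -> : energyB k m (v - e) =
    (k ^+ 2 + k * alpha + alpha ^+ 2 / 2) / 2 * (ip v v + ip e e)
    + alpha * (k + alpha / 2) * ip v e.
  by rewrite /energyB mE !ipE (ipC e v); field.
rewrite [ip e v]ipC.
have h1 := ip_ge0 ip_norm (v + e); have h2 := ip_ge0 ip_norm (v - e).
rewrite !ipE [ip e v]ipC in h1 h2.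
have v0 := ip_ge0 ip_norm v; have e0 := ip_ge0 ip_norm e.
have hXl : 0 <= lam * (alpha - 2) * ip X (v - e).
  by rewrite !mulr_ge0// subr_ge0 ltW.
set N := ip v v + ip e e in hB *.
have N0 : 0 <= N by rewrite /N; lra.
have hw : `|ip v e| <= N / 2 by rewrite ler_norml /N; apply/andP; split; lra.
set w := ip v e in hw *.
(* The total coefficient of w is (2 lam - alpha) k + 2 lam - alpha^2 / 2. Its k-part costs at most
   ((alpha - 2)/2 - 2 eps) k N out of the available (alpha - 2)/2 k N. Of the 2 eps k N left, half
   is the claimed decrease and half absorbs the constant terms, at most (1/2 + lam alpha) N. *)
have lw a : a * w <= `|a| * (N / 2).
  by apply: le_trans (ler_norm _) _; rewrite normrM ler_wpM2l.
have l1 := lw ((2 * lam - alpha) * k).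
have l2 := lw (2 * lam - alpha ^+ 2 / 2).
have l3 : `|(2 * lam - alpha) * k| <= (alpha - 2 - 4 * eps) * k.
  by rewrite normrM (ger0_norm k0) ler_wpM2r.
have l4 : `|2 * lam - alpha ^+ 2 / 2| <= 2 * lam + alpha ^+ 2 / 2.
  apply: le_trans (ler_normB _ _) _.
  by rewrite ger0_norm ?mulr_ge0// ger0_norm// divr_ge0 ?sqr_ge0.
have n5 : 0 <= N / 2 by lra.
have l5 := ler_wpM2r n5 l3.
have l6 := ler_wpM2r n5 l4.
have l7 := ler_wpM2r n5 hk.
have l8 : lam * (alpha - 1) * ip e e <= lam * (alpha - 1) * N.
  rewrite ler_wpM2l// ?mulr_ge0// ?subr_ge0; first by lra.
  by rewrite /N; lra.
lra.
Qed.

End Energy.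

(** * Limits of real sequences *)

Lemma near_nonincreasing_ge0_is_cvgn {R : realType} {E : R^nat} :
  (forall n, 0 <= E n) -> (\forall n \near \oo, E n.+1 <= E n) -> cvgn E.
Proof.
move=> E0 [K _ hK].
suff : cvgn [sequence E (n + K)%N]_n.
  by move=> /cvg_ex[l]; rewrite cvg_shiftn => El; apply/cvg_ex; exists l.
apply: nonincreasing_is_cvgn; last by exists 0 => _ [n _ <-]; exact: E0.
by apply/nonincreasing_seqP => n /=; apply: hK; rewrite /= leq_addl.
Qed.

(** If b > 0, each late step costs E at least (c b / 2) [harmonic n]; telescoping with E >= 0 would
    then bound the harmonic series. *)
Lemma cvg0_harmonic_dissipation {R : realType} {E B : R^nat} {b c : R} :
  0 < c -> (forall n, 0 <= E n) -> (forall n, 0 <= B n) -> B @ \oo --> b ->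
  (\forall n \near \oo, E n.+1 + c * harmonic n * B n <= E n) -> b = 0.
Proof.
move=> c0 E0 B0 Bb hE.
have b0 : 0 <= b.
  rewrite -(cvg_lim _ Bb)//; apply: limr_ge; last exact: nearW.
  by apply/cvg_ex; exists b.
apply/eqP/negPn/negP => bn0.
have bgt : 0 < b by rewrite lt_neqAle eq_sym bn0.
have hB : \forall n \near \oo, b / 2 <= B n.
  by apply: (cvgr_ge _ Bb); rewrite ltr_pdivrMr// mulr_natr mulr2n ltrDl.
have [K _ hK] : \forall n \near \oo, c * b / 2 * harmonic n <= E n - E n.+1.
  near=> n.
  have h1 : E n.+1 + c * harmonic n * B n <= E n by near: n.
  have h2 : b / 2 <= B n by near: n.
  have h3 := ler_wpM2l (mulr_ge0 (ltW c0) (harmonic_ge0 n)) h2.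
  by lra.
apply: (@dvg_harmonic R).
apply: nondecreasing_is_cvgn.
  by apply: nondecreasing_series => n _ _; exact: harmonic_ge0.
set C := c * b / 2 in hK.
have C0 : 0 < C by rewrite /C divr_gt0// mulr_gt0.
exists (series harmonic K + E K / C) => _ [n _ <-].
have [nK|Kn] := leqP n K.
  apply: (@le_trans _ _ (series harmonic K)).
    by apply: nondecreasing_series => // i _ _; exact: harmonic_ge0.
  by rewrite lerDl divr_ge0// ltW.
rewrite -lerBlDl ler_pdivlMr// mulrC.
suff : forall j, C * (series harmonic (K + j)%N - series harmonic K)
    <= E K - E (K + j)%N.
  move=> /(_ (n - K)%N); rewrite subnKC ?(ltnW Kn)// => /le_trans; apply.
  by rewrite gerBl.
elim=> [|j IH]; first by rewrite addn0 !subrr mulr0.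
have h : C * harmonic (K + j)%N <= E (K + j)%N - E (K + j).+1.
  exact: hK (leq_addr _ _).
by rewrite addnS seriesSr; lra.
Unshelve. all: by end_near.
Qed.

Lemma sqr_norm_cvg0 {K : realType} {V : normedModType K} (f : nat -> V) :
  (fun n => `|f n| ^+ 2) @ \oo --> (0 : K) -> f @ \oo --> (0 : V).
Proof.
move=> f0; apply: norm_cvg0.
have -> : (fun n => `|f n|) = fun n => Num.sqrt (`|f n| ^+ 2).
  by apply/funext => n; rewrite sqrtr_sqr normr_id.
rewrite -(sqrtr0 K).
by apply: (@continuous_cvg _ _ _ _ _ _ Num.sqrt) => //; exact: sqrt_continuous.
Qed.

(** * Convergence of the energies along the iterates *)

Section Trajectory.
Context {R : realType} {H : completeNormedModType R} {ip : {dot H for idfun}}.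
Hypothesis ip_norm : induces_norm ip.
Variables (Q : H -> H) (alpha : R) (x : nat -> H) (z : H).
Hypothesis Q_cocoercive : forall y w,
  ip (Q y - Q w) (Q y - Q w) / 2 <= ip (y - w) (Q y - Q w).
Hypothesis alpha_gt2 : 2 < alpha.
Hypothesis Qz : Q z = 0.

(* Indices are shifted by one with respect to the header: [v n], [m n] and [B n]
   stand for v_{n+1}, (n+1) v_{n+1} and B_{n+1}. *)
Let v n : H := x n.+1 - x n + Q (x n).
Let X n : H := x n.+1 - z.
Let m n : H := n.+1%:R *: v n.
Let q n : H := Q (x n.+1).

Hypothesis x_rec : forall n,
  (n.+1%:R + alpha) *: v n.+1 = n.+1%:R *: v n + (alpha / 2) *: q n.

Let A n := energyA (ip := ip) alpha (X n) (m n).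
Let B n := energyB (ip := ip) n.+1%:R (m n) (q n).

Lemma residual_ip_ge0 n : 0 <= ip (X n) (q n).
Proof.
have := Q_cocoercive (x n.+1) z; rewrite Qz subr0; apply: le_trans.
by rewrite divr_ge0// ip_ge0.
Qed.

(** The condition on [lam] reads 1 + 2 eps <= lam <= alpha - 1 - 2 eps. *)
Lemma energy_dissipation (lam eps : R) : 0 <= lam -> 0 < eps ->
  `|2 * lam - alpha| <= alpha - 2 - 4 * eps ->
  \forall n \near \oo, lam * A n.+1 + B n.+1 + eps / 2 * harmonic n * B n.+1
    <= lam * A n + B n.
Proof.
move=> lam0 eps0 hlam.
near=> n.
set k : R := n.+1%:R.
have k1 : 1 <= k by rewrite /k ler1n.
pose e := x n.+2 - x n.+1.
have vE : v n.+1 = e + q n by [].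
have qE : q n = v n.+1 - e by rewrite vE addrAC subrr add0r.
have XE : X n.+1 = X n + e by rewrite /X /e [RHS]addrC addrA subrK.
have kS : n.+2%:R = k + 1 :> R by rewrite /k natr1.
have mE : m n = (k + alpha / 2) *: v n.+1 + (alpha / 2) *: e.
  rewrite /m; apply: (addIr ((alpha / 2) *: q n)); rewrite -x_rec -/k qE.
  rewrite -addrA -scalerDr [e + _]addrC subrK -scalerDl.
  by congr (_ *: _); field.
have mono : ip (v n.+1) (v n.+1 - e) - ip (v n.+1 - e) (v n.+1 - e) / 2 <=
    ip (v n.+1) (q n.+1) - ip (q n.+1) (q n.+1) / 2.
  rewrite -qE; have := Q_cocoercive (x n.+2) (x n.+1).
  rewrite -/(q n.+1) -/(q n) -/e vE !ipE (ipC (q n) (q n.+1)); lra.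
have hk : 1 / 2 + lam * alpha <= eps * k.
  rewrite [eps * k]mulrC -ler_pdivrMr// /k -(natr1 n) -lerBlDr ltW//.
  by near: n; exact: nbhs_infty_gtr.
have Xe : 0 <= ip (X n) (v n.+1 - e) by rewrite -qE residual_ip_ge0.
have step :=
  energy_step ip_norm mE alpha_gt2 lam0 (le_trans ler01 k1) hlam hk Xe mono.
have hB := energyB_le (k + 1) mono.
move: step hB; rewrite -XE -qE -kS -/(m n.+1) -/(A n.+1) -/(B n.+1).
rewrite -/(A n) -/(B n) kS.
set N := _ + ip e e => step hB.
have N0 : 0 <= N by rewrite addr_ge0// ip_ge0.
(* Since k >= 1, [hB] gives B_{k+1} <= (k + 1)^2 N / 2 <= 2 k^2 N, and [harmonic n] is 1/k. *)
suff : eps / 2 * harmonic n * B n.+1 <= eps * k * N by lra.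
rewrite /harmonic /= -/k.
have k0 : 0 < k by exact: lt_le_trans k1.
have -> : eps * k * N = eps / 2 * k^-1 * (2 * k ^+ 2 * N).
  by field; rewrite gt_eqF.
apply: ler_wpM2l; first by rewrite !mulr_ge0// ?invr_ge0// ltW.
by apply: le_trans hB _; apply: ler_wpM2r => //; nra.
Unshelve. all: by end_near.
Qed.

Lemma energy_ge_norm lam n : 0 <= lam ->
  lam * (alpha - 1 - lam) * ip (X n) (X n) <= lam * A n + B n.
Proof. by move=> lam0; apply: energy_ge => //; exact: residual_ip_ge0. Qed.

Lemma energy_ge0 lam n : 0 <= lam <= alpha - 1 -> 0 <= lam * A n + B n.
Proof.
move=> /andP[lam0 lam1]; apply: le_trans (energy_ge_norm n lam0).
by rewrite !mulr_ge0 ?subr_ge0 ?ip_ge0.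
Qed.

Lemma energy_is_cvgn (lam eps : R) : 0 <= lam <= alpha - 1 -> 0 < eps ->
  `|2 * lam - alpha| <= alpha - 2 - 4 * eps ->
  cvgn (fun n => lam * A n + B n).
Proof.
move=> lamr eps0 hlam; have /andP[lam0 _] := lamr.
apply: near_nonincreasing_ge0_is_cvgn => [n|]; first exact: energy_ge0.
apply: filterS (energy_dissipation lam0 eps0 hlam) => n; apply: le_trans.
rewrite lerDl mulr_ge0 ?energyB_ge0// mulr_ge0 ?harmonic_ge0//.
by rewrite divr_ge0// ltW.
Qed.

Lemma energyAB_cvgn :
  exists a : R, A @ \oo --> a /\ B @ \oo --> (0 : R).
Proof.
have a2 := alpha_gt2.
(* The weight [lam] is the midpoint of the admissible interval. This [eps] puts [mu] at its right
   end, where |2 mu - alpha| = 4 eps = alpha - 2 - 4 eps. The two energies differ by 2 eps A. *)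
pose eps := (alpha - 2) / 8; have eps0 : 0 < eps by rewrite /eps; lra.
pose lam := alpha / 2; pose mu := alpha / 2 + 2 * eps.
have lamr : 0 <= lam <= alpha - 1 by rewrite /lam; apply/andP; split; lra.
have mur : 0 <= mu <= alpha - 1 by rewrite /mu /eps; apply/andP; split; lra.
have hlam : `|2 * lam - alpha| <= alpha - 2 - 4 * eps.
  by rewrite ler_norml /lam /eps; apply/andP; split; lra.
have hmu : `|2 * mu - alpha| <= alpha - 2 - 4 * eps.
  by rewrite ler_norml /mu /eps; apply/andP; split; lra.
have /cvg_ex[l1 hl1] := energy_is_cvgn lamr eps0 hlam.
have /cvg_ex[l2 hl2] := energy_is_cvgn mur eps0 hmu.
have hA : A @ \oo --> (2 * eps)^-1 * (l2 - l1).
  have -> : A = fun n => (2 * eps)^-1 * ((mu * A n + B n) - (lam * A n + B n)).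
    apply/funext => n; rewrite opprD addrACA subrr addr0 -mulrBl.
    by rewrite /mu addrAC subrr add0r mulKf// gt_eqF// mulr_gt0.
  by apply: cvgMr; exact: cvgB.
have hB : B @ \oo --> l1 - lam * ((2 * eps)^-1 * (l2 - l1)).
  have -> : B = fun n => (lam * A n + B n) - lam * A n.
    by apply/funext => n; rewrite addrAC subrr add0r.
  by apply: cvgB => //; exact: cvgMr.
exists ((2 * eps)^-1 * (l2 - l1)); split=> //.
have /andP[lam0 _] := lamr.
suff b0 : l1 - lam * ((2 * eps)^-1 * (l2 - l1)) = 0 by rewrite -[0]b0.
apply: (cvg0_harmonic_dissipation (E := fun n => lam * A n + B n)
  (B := fun n => B n.+1) (c := eps / 2)).
- by rewrite divr_gt0.
- by move=> n; exact: energy_ge0.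
- by move=> n; exact: energyB_ge0.
- by rewrite cvg_shiftS.
- exact: energy_dissipation.
Qed.

Lemma residual_cvg0 : (fun n => Q (x n)) @ \oo --> (0 : H).
Proof.
rewrite -cvg_shiftS; apply: sqr_norm_cvg0.
have [_ [_ hB]] := energyAB_cvgn.
apply: (@squeeze_cvgr _ _ _ _ (fun=> 0) (fun n => 4 * B n)).
- apply: nearW => n; rewrite sqr_ge0 -ip_norm /=.
  have k1 : 1 <= n.+1%:R ^+ 2 :> R by rewrite exprn_ege1// ler1n.
  apply: (@le_trans _ _ (n.+1%:R ^+ 2 * ip (q n) (q n))).
    by rewrite ler_peMl// ip_ge0.
  exact: energyB_ge_residual.
- exact: cvg_cst.
- by rewrite -(mulr0 4); exact: cvgMr.
Qed.

(** The cross term in A vanishes in the limit: |X|^2 is bounded by the convergent energy, while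
    |m|^2 <= 2 B tends to 0. So |X|^2 inherits the convergence of A. *)
Lemma distance_is_cvgn : cvgn (fun n => `|x n - z|).
Proof.
have a2 := alpha_gt2; have [a [hA hB]] := energyAB_cvgn.
pose lam := alpha / 2; have lam0 : 0 < lam by rewrite /lam; lra.
pose c := lam * (alpha - 1 - lam).
have c0 : 0 < c by rewrite mulr_gt0// /lam; lra.
have hXm : (fun n => ip (X n) (m n)) @ \oo --> (0 : R).
  apply: sqr_norm_cvg0.
  apply: (@squeeze_cvgr _ _ _ _ (fun=> 0)
    (fun n => c^-1 * (lam * A n + B n) * (2 * B n))).
  - apply: nearW => n; rewrite sqr_ge0 real_normK ?num_real//=.
    apply: le_trans (ip_sqr_le ip_norm _ _) _.
    apply: ler_pM; rewrite ?ip_ge0//.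
      by rewrite mulrC ler_pdivlMr// mulrC energy_ge_norm// ltW.
    rewrite /B /energyB mulrC divfK ?pnatr_eq0// lerDl ip_ge0//.
  - exact: cvg_cst.
  - rewrite -(mulr0 (c^-1 * (lam * a + 0))) -{2}(mulr0 2).
    apply: cvgM; last exact: cvgMr.
    by apply: cvgMr; apply: cvgD => //; exact: cvgMr.
have hX : (fun n => ip (X n) (X n)) @ \oo --> (alpha - 1)^-1 * (a - 2 * 0).
  have -> : (fun n => ip (X n) (X n)) =
      fun n => (alpha - 1)^-1 * (A n - 2 * ip (X n) (m n)).
    apply/funext => n; rewrite /A /energyA addrK mulKf// gt_eqF//; lra.
  by apply: cvgMr; apply: cvgB => //; exact: cvgMr.
apply/cvg_ex; exists (Num.sqrt ((alpha - 1)^-1 * (a - 2 * 0))).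
rewrite -cvg_shiftS.
have -> : [sequence `|x n.+1 - z|]_n = fun n => Num.sqrt (ip (X n) (X n)).
  by apply/funext => n; rewrite ip_norm sqrtr_sqr normr_id.
by apply: (@continuous_cvg _ _ _ _ _ _ Num.sqrt) => //; exact: sqrt_continuous.
Qed.

End Trajectory.

(** * Limits along ultrafilters *)

(** If the preimage of a neighbourhood N is not in F, then F restricted to its complement is proper
    and extends to an ultrafilter along which f avoids N. *)
Lemma cvg_ultra {I : Type} {T : topologicalType} (F : set_system I)
    (f : I -> T) (l : T) : Filter F ->
  (forall U, UltraFilter U -> F `<=` U -> f @ U --> l) -> f @ F --> l.
Proof.
move=> FF hU N Nl; apply: contrapT => nFN.
have PW : ProperFilter (within (~` (f @^-1` N)) F).
  apply: Build_ProperFilter_ex => A hA; apply: contrapT => A0.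
  apply: nFN; apply: (@filterS _ F _ _ _ _ hA) => i hi; apply: contrapT => ni.
  by apply: A0; exists i; exact: hi.
have [U [UU sU]] := ultraFilterLemma PW.
have FU : F `<=` U.
  by move=> A FA; apply: sU; rewrite /within; apply: filterS FA => i Ai _.
have UN : U (f @^-1` N) by exact: hU Nl.
have UnN : U (~` (f @^-1` N)).
  by apply: sU; rewrite /within; exact: (@filterS _ F _ setT _ _ filterT).
by have [i []] := filter_ex (filterI UN UnN).
Qed.

(** The image of U clusters in the compact segment, and a cluster point of an ultrafilter is a
    limit. *)
Lemma ultra_bounded_is_cvg {R : realType} {I : Type} (U : set_system I)
    (f : I -> R) (M : R) : UltraFilter U ->
  (forall i, `|f i| <= M) -> cvg (f @ U).
Proof.
move=> UU fM.
have [|l [_ cl]] := @segment_compact R (- M) M (f @ U) _.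
  apply: (@filterS _ U _ setT _ _ filterT) => i _ /=.
  by rewrite in_itv /= -ler_norml fM.
apply/cvg_ex; exists l => N Nl.
have [//|UnN] := in_ultra_setVsetC (f @^-1` N) UU.
have [y [nNy Ny]] := cl (~` N) N UnN Nl.
by [].
Qed.

Lemma cvg_ipl {R : realType} {H : completeNormedModType R}
    {ip : {dot H for idfun}} (ip_norm : induces_norm ip) {I : Type}
    (F : set_system I) (y : I -> H) (p u : H) : Filter F ->
  y @ F --> p -> (fun i => ip (y i) u) @ F --> ip p u.
Proof.
move=> FF yp; apply/cvgrPdist_le => e e0.
have w0 : 0 < `|u| + 1 by rewrite ltr_wpDl.
have /cvgrPdist_le /(_ (e / (`|u| + 1)) (divr_gt0 e0 w0)) := yp.
apply: filterS => i.
rewrite ler_pdivlMr// => h.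
have -> : ip p u - ip (y i) u = ip (p - y i) u by rewrite !ipE.
apply: le_trans (ip_norm_le ip_norm _ _) _; apply: le_trans h.
by rewrite ler_wpM2l// lerDl.
Qed.

(** * Riesz representation by minimization *)

Section Riesz.
Context {R : realType} {H : completeNormedModType R} {ip : {dot H for idfun}}.
Hypothesis ip_norm : induces_norm ip.

Lemma riesz_representation (L : H -> R) (M : R) :
  (forall a y w, L (a *: y + w) = a * L y + L w) ->
  (forall y, `|L y| <= M * `|y|) -> exists p, forall u, L u = ip p u.
Proof.
move=> Llin LM.
(* The representing vector minimizes J. *)
pose J y := ip y y - 2 * L y.
have Jge y : - M ^+ 2 <= J y.
  have h := sqr_ge0 (`|y| - M).
  have := le_trans (ler_norm _) (LM y).
  by rewrite /J ip_norm; nra.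
have LD y w : L (y + w) = L y + L w by rewrite -[y]scale1r Llin mul1r scale1r.
have L0 : L 0 = 0 by have := LD 0 0; rewrite addr0; lra.
have LZ a y : L (a *: y) = a * L y by rewrite -[a *: y]addr0 Llin L0 addr0.
have infJ : has_inf (range J).
  split; first by exists (J 0), 0.
  by exists (- M ^+ 2) => _ [y _ <-].
pose j := inf (range J).
have jle y : j <= J y by apply: ge_inf; [case: infJ|exists y].
have /choice[y hy] n : exists y, J y < j + n.+1%:R^-1.
  have n0 : 0 < n.+1%:R^-1 :> R by rewrite invr_gt0.
  have [_ [y _ <-] hy] := inf_adherent n0 infJ.
  by exists y.
(* Parallelogram identity: |y_n - y_k|^2 = 2 J(y_n) + 2 J(y_k) - 4 J((y_n + y_k)/2), the terms in
   [L] cancelling. *)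
have ycauchy n k : (n <= k)%N -> ip (y n - y k) (y n - y k) <= 4 / n.+1%:R.
  move=> nk; have h1 := hy n; have h2 := hy k.
  have h3 := jle (2^-1 *: (y n + y k)).
  have h4 : k.+1%:R^-1 <= n.+1%:R^-1 :> R by rewrite lef_pV2 ?posrE// ler_nat.
  move: h1 h2 h3 h4; move: (n.+1%:R^-1) (k.+1%:R^-1) => a b.
  rewrite /J LZ LD !ipE (ipC (y k) (y n)).
  by lra.
have /cvg_ex[p yp] : cvg (y @ \oo).
  apply: cauchy_cvg; apply: cauchy_exP => e e0.
  have [N _ /(_ N (leqnn N)) hN] : \forall n \near \oo, harmonic n < e ^+ 2 / 4.
    by apply: (cvgr_lt _ cvg_harmonic); rewrite divr_gt0 ?exprn_gt0.
  exists (y N); exists N => // n /= Nn.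
  rewrite -ball_normE /= -(@ltr_pXn2r _ 2)// ?nnegrE ?(ltW e0)// -ip_norm.
  by apply: le_lt_trans (ycauchy _ _ Nn) _; rewrite mulrC -ltr_pdivlMr.
exists p => u; apply/esym/eqP; rewrite -subr_eq0; apply/eqP.
have cvg1 : (fun n => ip (y n) u - L u) @ \oo --> ip p u - L u.
  by apply: cvgB; [exact: cvg_ipl|exact: cvg_cst].
apply: (cvg_unique _ cvg1) => //; apply: sqr_norm_cvg0.
(* Comparing J(y_n) with J(y_n - t u) for t = c/w, where c = <y_n, u> - L u, gives c^2 <= w / (n +
   1). The added 1 keeps w positive when u = 0. *)
pose w := ip u u + 1.
have w0 : 0 < w by rewrite ltr_wpDl ?ip_ge0.
apply: (@squeeze_cvgr _ _ _ _ (fun=> 0) (fun n => harmonic n * w)).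
- apply: nearW => n; rewrite sqr_ge0 real_normK ?num_real//=.
  set c := ip (y n) u - L u.
  have := jle (y n + (- (c / w)) *: u); have := hy n.
  rewrite /J LD LZ !ipE (ipC u (y n)) -ler_pdivrMr//.
  have -> : c ^+ 2 / w = (c / w) ^+ 2 * w by field; rewrite gt_eqF.
  have cE : c = c / w * w by rewrite divfK// gt_eqF.
  have iE : ip (y n) u = c / w * w + L u by rewrite -cE /c subrK.
  rewrite iE; move: (c / w) => t; rewrite /w.
  have := sqr_ge0 t; move: (n.+1%:R^-1) => a; nra.
- exact: cvg_cst.
- by rewrite -(mul0r w); apply: cvgMl; exact: cvg_harmonic.
Qed.

End Riesz.

(** * Weak cluster points, Opial's lemma and demiclosedness *)

Section Opial.
Context {R : realType} {H : completeNormedModType R} {ip : {dot H for idfun}}.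
Hypothesis ip_norm : induces_norm ip.

(** For each u the bounded scalars <x_i, u> have a limit along U; as a function of u it is linear
    and bounded by M |u|, hence represented by a vector. *)
Lemma bounded_ultra_weak_cvg {I : Type} (U : set_system I) (x : I -> H)
    (M : R) : UltraFilter U -> (forall i, `|x i| <= M) ->
  exists p, forall u, (fun i => ip (x i) u) @ U --> ip p u.
Proof.
move=> UU xM.
have bnd u i : `|ip (x i) u| <= M * `|u|.
  by apply: le_trans (ip_norm_le ip_norm _ _) _; rewrite ler_wpM2r.
have /choice[L hL] u : exists l : R, (fun i => ip (x i) u) @ U --> l.
  by have /cvg_ex := ultra_bounded_is_cvg UU (bnd u).
have [a y w|u|p Lp] := riesz_representation ip_norm (L := L) (M := M).
- apply: (cvg_unique _ (hL (a *: y + w))) => //.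
  have -> : (fun i => ip (x i) (a *: y + w)) =
      (fun i => a * ip (x i) y + ip (x i) w).
    by apply/funext => i; rewrite !ipE.
  by apply: cvgD; [exact: cvgMr|].
- have hn : (fun i => `|ip (x i) u|) @ U --> `|L u|.
    by apply: cvg_norm; exact: hL.
  rewrite -(cvg_lim _ hn)//; apply: limr_le; last exact: nearW (bnd u).
  by apply/cvg_ex; exists `|L u|.
- by exists p => u; rewrite -Lp.
Qed.

Lemma cvg_dist_bounded (x : nat -> H) (z : H) :
  cvgn (fun n => `|x n - z|) -> exists M, forall n, `|x n| <= M.
Proof.
move=> /cvg_seq_bounded [N [_ hN]].
exists (N + 1 + `|z|) => n.
have /= := hN (N + 1) _ n I; rewrite ltrDl ltr01 normr_id => /(_ isT) h.
rewrite -[x n](subrK z); apply: le_trans (ler_normD _ _) _.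
by rewrite lerD2r.
Qed.

Lemma opial (C : set H) (x : nat -> H) : C !=set0 ->
  (forall z, C z -> cvgn (fun n => `|x n - z|)) ->
  (forall U p, UltraFilter U -> \oo `<=` U ->
    (forall u, (fun n => ip (x n) u) @ U --> ip p u) -> C p) ->
  exists p, C p /\ weakly_converges ip x p.
Proof.
move=> [z Cz] xC UC.
have [M xM] := cvg_dist_bounded (xC z Cz).
have wl U : UltraFilter U -> \oo `<=` U ->
    exists2 p, C p & forall u, (fun n => ip (x n) u) @ U --> ip p u.
  move=> UU sU; have [p xp] := bounded_ultra_weak_cvg UU xM.
  by exists p => //; exact: UC xp.
have [U [UU sU]] := ultraFilterLemma (F := \oo) _.
have [p Cp Up] := wl U UU sU.
exists p; split=> // u; apply: cvg_ultra => W WU sW.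
have [p' Cp' Wp'] := wl W WU sW.
suff <- : p' = p by exact: Wp'.
(* By polarization this is a combination of |x_n - p|^2, |x_n - p'|^2 and constants, so it converges
   along the whole sequence. Its limits along U and W agree, giving <p, p' - p> = <p', p' - p>. *)
have [l hl] : exists l : R, (fun n => ip (x n) (p' - p)) @ \oo --> l.
  have /cvg_ex[a ha] := xC _ Cp; have /cvg_ex[b hb] := xC _ Cp'.
  exists (2^-1 * (a * a - b * b + (ip p' p' - ip p p))).
  have -> : (fun n => ip (x n) (p' - p)) = (fun n => 2^-1 *
      (`|x n - p| * `|x n - p| - `|x n - p'| * `|x n - p'|
        + (ip p' p' - ip p p))).
    apply/funext => n; rewrite -!expr2 -!ip_norm !ipE.
    by rewrite (ipC p (x n)) (ipC p' (x n)); field.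
  apply: cvgMr; apply: cvgD; last exact: cvg_cst.
  by apply: cvgB; exact: cvgM.
apply/eqP; rewrite -subr_eq0; apply/eqP/(ip_eq0 ip_norm).
have e1 : l = ip p (p' - p).
  by apply: (cvg_unique _ (cvg_trans (cvg_app _ sU) hl)) => //; exact: Up.
have e2 : l = ip p' (p' - p).
  by apply: (cvg_unique _ (cvg_trans (cvg_app _ sW) hl)) => //; exact: Wp'.
by rewrite ipDl ipNl -e1 -e2 subrr.
Qed.

Lemma demiclosed {I : Type} (F : set_system I) (S : H -> H) (x : I -> H)
    (M : R) (p : H) : ProperFilter F -> nonexpansive S ->
  (forall i, `|x i| <= M) ->
  (forall u, (fun i => ip (x i) u) @ F --> ip p u) ->
  (fun i => x i - S (x i)) @ F --> (0 : H) -> S p = p.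
Proof.
move=> FF Sne xM xp xS.
pose d i := `|x i - S (x i)|.
have d0 : d @ F --> (0 : R) by rewrite -(normr0 H); exact: cvg_norm.
(* This bounds |p - S p|^2: compare |x_i - S p| <= d_i + |x_i - p|, squared, with the expansion of
   |x_i - S p|^2 around p. *)
pose g i := d i * d i + 2 * (M + `|p|) * d i
  - 2 * (ip (x i) (p - S p) - ip p (p - S p)).
have g0 : g @ F --> (0 : R).
  rewrite [X in _ --> X](_ : _ = 0 * 0 + 2 * (M + `|p|) * 0
    - 2 * (ip p (p - S p) - ip p (p - S p))); last first.
    by rewrite subrr !mulr0 subr0 addr0.
  apply: cvgB; first by apply: cvgD; [exact: cvgM|exact: cvgMr].
  by apply: cvgMr; apply: cvgB; [exact: xp|exact: cvg_cst].
apply/esym/eqP; rewrite -subr_eq0; apply/eqP/(ip_eq0 ip_norm).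
apply/eqP; rewrite eq_le ip_ge0// andbT -(cvg_lim _ g0)//.
apply: limr_ge; first by apply/cvg_ex; exists 0.
apply: nearW => i.
have h1 : `|x i - S p| <= d i + `|x i - p|.
  rewrite -[x i - S p](subrKA (S (x i))).
  by apply: le_trans (ler_normD _ _) _; rewrite lerD2l Sne.
have h2 : `|x i - p| <= M + `|p|.
  by apply: le_trans (ler_normB _ _) _; rewrite lerD2r xM.
have h3 : `|x i - S p| ^+ 2 <= (d i + `|x i - p|) ^+ 2.
  by rewrite ler_pXn2r// ?nnegrE ?addr_ge0// /d.
have h4 : `|x i - S p| ^+ 2 = `|x i - p| ^+ 2
    + 2 * (ip (x i) (p - S p) - ip p (p - S p)) + ip (p - S p) (p - S p).
  by rewrite -!ip_norm !ipE (ipC p (x i)) (ipC (S p) (x i)) (ipC (S p) p); ring.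
have d_ge0 : 0 <= d i by exact: normr_ge0.
by rewrite /g; nra.
Qed.

End Opial.

(** * Averaged operators and weak convergence of Fast KM *)

(** The map equals (1 - s theta) Id + s theta S, a convex combination because s theta <= 1. *)
Lemma relaxation_nonexpansive {R : realType} {H : normedModType R}
    (theta s : R) (T : H -> H) : 0 < theta -> 0 <= s -> s <= 1 / theta ->
  averaged theta T -> nonexpansive (fun y => y - s *: (y - T y)).
Proof.
move=> theta0 s0 s_le [S [Sne TE]] y w.
have r0 : 0 <= s * theta by rewrite mulr_ge0// ltW.
have r1 : 0 <= 1 - s * theta by rewrite subr_ge0 -ler_pdivlMr.
have E a : a - s *: (a - T a) = (1 - s * theta) *: a + (s * theta) *: S a.
  have -> : a - T a = theta *: (a - S a).
    rewrite TE scalerBl scale1r scalerBr opprD opprB.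
    by rewrite addrA addrCA subrr addr0.
  rewrite scalerA scalerBr scalerBl scale1r opprB -[RHS]addrA.
  by rewrite [- _ + _]addrC.
rewrite !E opprD addrACA -!scalerBr.
apply: le_trans (ler_normD _ _) _.
rewrite 2!normrZ (ger0_norm r0) (ger0_norm r1).
by have := ler_wpM2l r0 (Sne y w); nra.
Qed.

(** Expand |d - q|^2 <= |d|^2 with d = y - w and q = Q y - Q w. *)
Lemma nonexpansive_cocoercive {R : realType} {H : completeNormedModType R}
    {ip : {dot H for idfun}} (ip_norm : induces_norm ip)
    (Q : H -> H) (y w : H) :
  nonexpansive (fun y => y - Q y) ->
  ip (Q y - Q w) (Q y - Q w) / 2 <= ip (y - w) (Q y - Q w).
Proof.
move=> /(_ y w) /=; rewrite opprD addrACA -opprD => h.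
have := lerXn2r 2 (normr_ge0 _) (normr_ge0 _) h; rewrite /= -!ip_norm.
move: (y - w) (Q y - Q w) => d q.
by rewrite !ipE (ipC q d); lra.
Qed.

Theorem theorem3p4 (R : realType) (H : completeNormedModType R)
    (ip : {dot H for idfun}) (ip_norm : induces_norm ip)
    (theta : R) (theta_gt0 : 0 < theta) (theta_le1 : theta <= 1)
    (T : H -> H) (T_averaged : averaged theta T)
    (Fix_neq0 : Fix T !=set0)
    (alpha : R) (alpha_gt2 : 2 < alpha) (x0 x1 : H)
    (s : R) (s_gt0 : 0 < s) (s_le : s <= 1 / theta)
    (x : nat -> H) (x_KM : fast_KM T alpha s x0 x1 x) :
  exists p : H, Fix T p /\ weakly_converges ip x p.
Proof.
pose Q y := s *: (y - T y).
have Sne : nonexpansive (fun y => y - Q y).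
  exact: relaxation_nonexpansive (ltW s_gt0) s_le T_averaged.
have coco y w := nonexpansive_cocoercive ip_norm y w Sne.
have FixQ z : Fix T z -> Q z = 0.
  by rewrite /Fix /Q /= => <-; rewrite subrr scaler0.
have x_rec n : (n.+1%:R + alpha) *: (x n.+2 - x n.+1 + Q (x n.+1)) =
    n.+1%:R *: (x n.+1 - x n + Q (x n)) + (alpha / 2) *: Q (x n.+1).
  have [_ _ /(_ n.+1 isT) /= ->] := x_KM.
  (* Testing against every u turns the vector identity into a scalar one that [field] decides. *)
  apply: (ip_ext ip_norm) => u; rewrite /Q !ipE; field.
  by rewrite gt_eqF// ltr_wpDl// (lt_trans _ alpha_gt2).
have dist z : Fix T z -> cvgn (fun n => `|x n - z|).
  move=> /FixQ Qz; exact: distance_is_cvgn x_rec.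
apply: opial => // U p UU sU xp.
have [z /[dup] /dist hz /FixQ Qz] := Fix_neq0.
have Q0 := residual_cvg0 ip_norm coco alpha_gt2 Qz x_rec.
have [M xM] := cvg_dist_bounded hz.
have Sp : p - Q p = p.
  apply: (demiclosed ip_norm _ Sne xM xp).
  have -> : (fun n => x n - (x n - Q (x n))) = (fun n => Q (x n)).
    by apply/funext => n; rewrite opprB addrC subrK.
  exact: cvg_trans (cvg_app _ sU) Q0.
have /eqP : Q p = 0 by rewrite -[LHS](subKr p) Sp subrr.
by rewrite scaler_eq0 gt_eqF//= subr_eq0 => /eqP.
Qed.
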